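(* Let $k\ge 2$ and $\ell\ge 1$ be integers, and let $F\in\mathbb{C}[z_1^{\pm1},\dots,z_\ell^{\pm1}]$ be a nonzero Laurent polynomial in $\ell$ variables that is the sum of $k$ monomials. Then $$M(F)\ \ge\ \frac{h(F)}{2^{k-2}}.$$
   Context: A Laurent polynomial that is the sum of $k$ monomials is one of the form $F(z_1,\dots,z_\ell)=\sum_{\mathbf{j}\in J}c(\mathbf{j})\,z_1^{j_1}\cdots z_\ell^{j_\ell}$, where $J\subset\mathbb{Z}^\ell$ has $k$ elements $\mathbf{j}=(j_1,\dots,j_\ell)$ and $c(\mathbf{j})\in\mathbb{C}$. The height $h(F)$ is the maximum modulus of the coefficients of $F$. For nonzero $F$, the logarithmic Mahler measure is $$m(F)=\int_0^1\cdots\int_0^1\log|F(e^{2\pi i t_1},\dots,e^{2\pi i t_\ell})|\,dt_1\cdots dt_\ell,$$ and the Mahler measure is $M(F)=\exp(m(F))$. *)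

(* Defs.v *)
From HB Require Import structures.
From mathcomp Require Import all_boot all_order all_algebra finmap.
From mathcomp Require Import complex.
From mathcomp Require Import all_classical all_reals all_analysis.
Set Implicit Arguments.
Unset Strict Implicit.
Unset Printing Implicit Defensive.

Import Order.TTheory GRing.Theory Num.Theory.

Local Open Scope fset_scope.
Local Open Scope classical_set_scope.
Local Open Scope ring_scope.
Local Open Scope complex_scope.

(* A Laurent polynomial in l variables is encoded by its finitely supported
   family of coefficients: F j is the coefficient of z_1^{j_1} ... z_l^{j_l}. *)
Definition laurent (R : realType) (l : nat) : Type :=
  {fsfun l.-tuple int -> R[i] with 0}.

(* The coefficients c j, j \in J, are allowed to vanish. *)
Definition sum_of_monomials (R : realType) (l k : nat) (F : laurent R l) : Prop :=
  exists (J : {fset l.-tuple int}) (c : l.-tuple int -> R[i]),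
    #|` J| = k /\ F = [fsfun j in J => c j].

Definition laurent_eval (R : realType) (l : nat) (F : laurent R l)
    (z : l.-tuple R[i]) : R[i] :=
  \sum_(j <- finsupp F) F j * \prod_(i < l) tnth z i ^ tnth j i.

Definition height (R : realType) (l : nat) (F : laurent R l) : R :=
  \big[Num.max/0]_(j <- finsupp F) Normc.normc (F j).

(* e^{2 pi i t} *)
Definition unit_circle (R : realType) (t : R) : R[i] :=
  cos (2 * pi * t) +i* sin (2 * pi * t).

(* The iterated Lebesgue integral of f over [0, 1]^n, the first coordinate
   being the innermost variable of integration. *)
Fixpoint cube_integral (R : realType) (n : nat) :
    (n.-tuple R -> \bar R) -> \bar R :=
  match n with
  | 0 => fun f => f [tuple]
  | n'.+1 => fun f => cube_integral (fun t : n'.-tuple R =>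
      (\int[@lebesgue_measure R]_(x in `[0%R, 1%R]) f [tuple of x :: t])%E)
  end.

(* The values are extended reals, with log 0 = -oo and exp (-oo) = 0. *)
Definition log_mahler_measure (R : realType) (l : nat) (F : laurent R l) :
    \bar R :=
  cube_integral (fun t : l.-tuple R =>
    lne (Normc.normc (laurent_eval F (map_tuple (@unit_circle R) t)))%:E).

Definition mahler_measure (R : realType) (l : nat) (F : laurent R l) : \bar R :=
  expeR (log_mahler_measure F).

(* Main.v *)
(* Reduction to one variable: collect F by powers of the innermost variable.  If k_1
   distinct exponents n occur there, with coefficients a_n (Laurent polynomials in the other
   variables), then for fixed values of the other variables the one-variable bound gives
   M(F) >= M(a_n) / 2^(k_1 - 2), and a_n has at most k - k_1 + 1 monomials; choosing n so that
   a_n contains a largest coefficient of F, induction on the number of variables concludes.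

   In one variable, let f = c prod (X - a) have degree n and f(0) <> 0.  Reflecting the roots
   outside the closed unit disk gives g with |g| = |f| on the unit circle, all roots in the disk,
   and |lead g| = |c| prod max(1, |a|) =: M'(f).  Two facts remain.

   (1) The integral of log |g(e(t))| is at least log |lead g|.  The average of log |g| over N
   equally spaced points of the circle of radius r_N = exp(1/N) is a sum of logarithms of
   |r_N^N - a^N| >= e - 1 >= 1 plus log |lead g|; let N -> oo by Fatou's lemma.

   (2) |f_e| <= 2^(k-2) M'(f) for every coefficient.  By Gauss-Lucas applied to f - lambda g,
   |f'| <= |g'| outside the closed disk; comparing products over the same sampling points
   yields M'(f') <= n M'(f).  If 2e >= n, then f' has one monomial less and the coefficient
   e f_e, so the bound for f' gives the one for f; otherwise exchange f with its reversal.
   The endpoints e = 0 and e = n satisfy |f_e| <= M'(f) directly. *)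

Require Import Defs.
From mathcomp Require Import all_boot all_order all_algebra finmap.
From mathcomp Require Import all_classical all_reals all_analysis.
From mathcomp Require Import complex measurable_realfun ring lra zify.
Set Implicit Arguments.
Unset Strict Implicit.
Unset Printing Implicit Defensive.

Import Order.TTheory GRing.Theory Num.Theory.
Import numFieldNormedType.Exports.

Local Open Scope ring_scope.

(** * Polynomials given by their roots *)

Section RootSequences.
Variable K : numClosedFieldType.
Implicit Types (a c w z : K) (s t : seq K).

Definition split_poly c s : {poly K} := c *: \prod_(a <- s) ('X - a%:P).

Definition outer a : K := if `|a| <= 1 then 1 else `|a|.

(** Inversion in the unit circle, applied only to points outside the closed disk. *)
Definition inward a : K := if `|a| <= 1 then a else (a^*)^-1.

(* The Mahler measure as given by Jensen's formula. *)
Definition root_mahler c s : K := `|c| * \prod_(a <- s) outer a.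

Lemma horner_split_poly c s z :
  (split_poly c s).[z] = c * \prod_(a <- s) (z - a).
Proof.
rewrite hornerZ horner_prod; congr (_ * _).
by apply: eq_bigr => a _; rewrite hornerXsubC.
Qed.

Lemma lead_coef_split_poly c s : lead_coef (split_poly c s) = c.
Proof. by rewrite lead_coefZ lead_coef_prod_XsubC mulr1. Qed.

Lemma size_split_poly c s : c != 0 -> size (split_poly c s) = (size s).+1.
Proof. by move=> c0; rewrite size_scale // size_prod_XsubC. Qed.

Lemma split_polyP (p : {poly K}) : exists s, p = split_poly (lead_coef p) s.
Proof. by have [s sP] := closed_field_poly_normal p; exists s. Qed.

Lemma outer_ge1 a : 1 <= outer a.
Proof.
rewrite /outer; case: ifPn => // /negP an; apply/ltW.
by rewrite real_ltNge ?num_real ?normr_real ?real1 //; apply/negP.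
Qed.

Lemma outer_ge_norm a : `|a| <= outer a.
Proof. by rewrite /outer; case: ifP. Qed.

Lemma inward_le1 a : `|inward a| <= 1.
Proof.
rewrite /inward; case: ifPn => //.
rewrite -real_ltNge ?normr_real ?real1 // => a1.
rewrite normfV norm_conjC invf_le1 ?ltW //.
exact: lt_trans a1.
Qed.

(** For |a| > 1 both sides are squared: with b the conjugate of a, |b z - 1|^2 - |z - a|^2 = (|a|^2
    - 1)(|z|^2 - 1). This is nonnegative for |z| >= 1 and vanishes on the circle, which gives the
    equality in the next lemma. *)
Lemma normB_outer_inward a z : 1 <= `|z| ->
  `|z - a| <= outer a * `|z - inward a|.
Proof.
move=> z1; rewrite /outer /inward; case: ifPn => [|]; first by rewrite mul1r.
rewrite -real_ltNge ?normr_real ?real1 // => a1.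
have a0 : a != 0 by rewrite -normr_gt0 (lt_trans _ a1).
have ac0 : a^* != 0 by rewrite conjC_eq0.
rewrite -(norm_conjC a) -normrM mulrBr divff //.
rewrite -(@ler_pXn2r _ 2) ?nnegrE // !normCK -subr_ge0.
have -> : (a^* * z - 1) * (a^* * z - 1)^* - (z - a) * (z - a)^* =
          (`|a| ^+ 2 - 1) * (`|z| ^+ 2 - 1).
  rewrite !normCK !rmorphB !rmorphM /= conjCK rmorph1; ring.
by rewrite mulr_ge0 // subr_ge0 exprn_ege1 // ltW.
Qed.

Lemma normB_outer_inward1 a z : `|z| = 1 ->
  `|z - a| = outer a * `|z - inward a|.
Proof.
move=> z1; rewrite /outer /inward; case: ifPn => [|]; first by rewrite mul1r.
rewrite -real_ltNge ?normr_real ?real1 // => a1.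
have a0 : a != 0 by rewrite -normr_gt0 (lt_trans _ a1).
have ac0 : a^* != 0 by rewrite conjC_eq0.
rewrite -(norm_conjC a) -normrM mulrBr divff //.
apply/eqP; rewrite -(@eqrXn2 _ 2) // !normCK eq_sym -subr_eq0.
have -> : (a^* * z - 1) * (a^* * z - 1)^* - (z - a) * (z - a)^* =
          (`|a| ^+ 2 - 1) * (`|z| ^+ 2 - 1).
  rewrite !normCK !rmorphB !rmorphM /= conjCK rmorph1; ring.
by rewrite z1 expr1n subrr mulr0.
Qed.

Lemma prod_outer_ge1 s : 1 <= \prod_(a <- s) outer a.
Proof.
elim/big_rec: _ => // a x _ x1.
by rewrite -[1]mulr1 ler_pM ?ler01 ?outer_ge1.
Qed.

Lemma root_mahler_ge0 c s : 0 <= root_mahler c s.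
Proof.
by rewrite mulr_ge0 // (le_trans ler01) ?prod_outer_ge1.
Qed.

Lemma norm_le_root_mahler c s : `|c| <= root_mahler c s.
Proof.
by rewrite ler_peMr ?prod_outer_ge1.
Qed.

Lemma norm_coef0_le_root_mahler c s :
  `|(split_poly c s)`_0| <= root_mahler c s.
Proof.
rewrite -horner_coef0 horner_split_poly normrM ler_wpM2l // normr_prod.
apply: ler_prod => a _; rewrite normr_ge0 sub0r normrN; exact: outer_ge_norm.
Qed.

(** The extra factor makes up for the moved roots on the unit circle, and the leading coefficient
    gets modulus [root_mahler c s]. *)
Definition reflected c s :=
  split_poly (c * \prod_(a <- s) outer a) (map inward s).

Lemma norm_split_poly_le_reflected c s z : 1 <= `|z| ->
  `|(split_poly c s).[z]| <= `|(reflected c s).[z]|.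
Proof.
move=> z1; rewrite !horner_split_poly big_map -mulrA -big_split /=.
rewrite !normrM ler_wpM2l // !normr_prod.
apply: ler_prod => a _; rewrite normr_ge0 normrM.
by rewrite (ger0_norm (le_trans ler01 (outer_ge1 a))) normB_outer_inward.
Qed.

Lemma norm_reflected c s z : `|z| = 1 ->
  `|(reflected c s).[z]| = `|(split_poly c s).[z]|.
Proof.
move=> z1; rewrite !horner_split_poly big_map -mulrA -big_split /=.
rewrite !normrM !normr_prod; congr (_ * _).
apply: eq_bigr => a _; rewrite normrM.
by rewrite (ger0_norm (le_trans ler01 (outer_ge1 a))) -normB_outer_inward1.
Qed.

Lemma deriv_split_poly c s z : all (fun a => z != a) s ->
  (split_poly c s)^`().[z] = (split_poly c s).[z] * \sum_(a <- s) (z - a)^-1.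
Proof.
move=> zs; rewrite horner_split_poly derivZ hornerZ -mulrA; congr (_ * _).
elim: s zs => [|a s IHs] /= ; first by rewrite !big_nil derivC hornerC mulr0.
case/andP=> za zs; have za0 : z - a != 0 by rewrite subr_eq0.
rewrite !big_cons derivM derivXsubC mul1r hornerD hornerM hornerXsubC IHs //.
rewrite horner_prod.
under eq_bigr do rewrite hornerXsubC.
by rewrite mulrDr mulrAC divff // mul1r mulrA.
Qed.

(** The logarithmic derivative times z is the sum of the z / (z - a), and each term has positive
    real part when |a| <= 1 < |z|. *)
Lemma gauss_lucas c s z : c != 0 -> (0 < size s)%N ->
  all (fun a => `|a| <= 1) s -> 1 < `|z| -> (split_poly c s)^`().[z] != 0.
Proof.
move=> c0 s0 s1 z1.
have zs a : a \in s -> z - a != 0.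
  move=> /(allP s1) a1; rewrite subr_eq0; apply: contraTneq z1 => ->.
  by rewrite -real_leNgt ?normr_real ?real1.
rewrite deriv_split_poly; last first.
  by apply/allP => a /zs; rewrite subr_eq0.
rewrite mulf_neq0 //.
  rewrite horner_split_poly mulf_neq0 //.
  rewrite prodf_seq_neq0.
  by apply/allP => a /zs.
(* Adding the conjugate gives twice the real part. *)
suff : 0 < z * (\sum_(a <- s) (z - a)^-1) + (z * (\sum_(a <- s) (z - a)^-1))^*.
  by apply: contraTneq => ->; rewrite mulr0 rmorph0 addr0 ltxx.
rewrite mulr_sumr rmorph_sum -big_split /=.
have pos a : a \in s -> 0 < z / (z - a) + (z / (z - a))^*.
  move=> sa; have za := zs _ sa.
  have zac : (z - a)^* != 0 by rewrite conjC_eq0.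
  have -> : z / (z - a) + (z / (z - a))^* =
            1 + (`|z| ^+ 2 - `|a| ^+ 2) / `|z - a| ^+ 2.
    rewrite !normCK !rmorphM fmorphV rmorphB /=; rewrite rmorphB /= in zac.
    by field; rewrite za zac.
  rewrite ltr_wpDr // divr_ge0 ?exprn_ge0 // subr_ge0 lerXn2r ?nnegrE //.
  by rewrite (le_trans (allP s1 _ sa)) // ltW.
case: s s0 pos {s1 zs} => // a s _ pos.
rewrite big_cons ltr_wpDr ?pos ?mem_head // big_seq sumr_ge0 // => b sb.
by rewrite ltW // pos // in_cons sb orbT.
Qed.

(** Bernstein's principle: an inequality of moduli outside the disk passes to the derivatives when
    the larger polynomial has all its roots in the disk. *)
Lemma bernstein c s z : c != 0 -> (0 < size s)%N -> 1 < `|z| ->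
  `|(split_poly c s)^`().[z]| <= `|(reflected c s)^`().[z]|.
Proof.
move=> c0 s0 z1; set f := split_poly c s; set g := reflected c s.
set o := \prod_(a <- s) outer a.
have o1 : 1 <= o := prod_outer_ge1 s.
have o0 : o != 0 by rewrite gt_eqF // (lt_le_trans _ o1).
have all1 : all (fun a => `|a| <= 1) (map inward s).
  by rewrite all_map; apply/allP => a _; exact: inward_le1.
have g0 : g^`().[z] != 0 by apply: gauss_lucas; rewrite ?mulf_neq0 ?size_map.
rewrite real_leNgt ?normr_real //; apply/negP => fg.
pose l := f^`().[z] / g^`().[z].
have l1 : 1 < `|l| by rewrite normf_div ltr_pdivlMr ?normr_gt0 // mul1r.
(* f - l g still has all its roots in the closed disk but a critical point z outside. *)
pose h := f - l *: g.
have hz : h^`().[z] = 0.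
  by rewrite derivB (derivZ l g) hornerD hornerN (hornerZ l) /l divfK ?subrr.
have sf : size f = (size s).+1 by rewrite size_split_poly.
have sg : size g = (size s).+1 by rewrite size_split_poly ?mulf_neq0 // size_map.
(* No drop of degree: the coefficient is c (1 - l o), and |l o| > 1. So h has as many roots as f,
   and Gauss-Lucas applies to it. *)
have hn : h`_(size s) != 0.
  rewrite coefB (coefZ l g).
  have -> : f`_(size s) = c by rewrite -(lead_coef_split_poly c s) lead_coefE sf.
  have -> : g`_(size s) = c * o.
    by rewrite -(lead_coef_split_poly (c * o) (map inward s)) lead_coefE sg.
  rewrite subr_eq0 mulrCA -{1}[c]mulr1; apply/negP => /eqP/(mulfI c0).
  move=> /(congr1 Num.norm)/eqP; rewrite normr1 lt_eqF // normrM.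
  by rewrite (lt_le_trans l1) // ler_peMr // ger0_norm // (le_trans ler01).
have sh : size h = (size s).+1.
  apply/eqP; rewrite eqn_leq; apply/andP; split.
    rewrite (leq_trans (size_polyD _ _)) // size_polyN geq_max sf leqnn.
    by rewrite (leq_trans (size_scale_leq _ _)) // sg.
  by rewrite ltnNge; apply: contra hn => /leq_sizeP ->.
have [t ht] := split_polyP h.
have h0 : lead_coef h != 0 by rewrite lead_coef_eq0 -size_poly_eq0 sh.
have st : size t = size s.
  by move: sh; rewrite ht size_split_poly // => -[].
have := @gauss_lucas (lead_coef h) t z h0.
rewrite st -ht hz eqxx => /(_ s0) gl.
suff t1 : all (fun a => `|a| <= 1) t by have := gl t1 z1.
(* A root b of h outside the disk would give |f(b)| = |l| |g(b)| > |g(b)|, against the comparison of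
   f and g there. *)
apply/allP => b bt; rewrite real_leNgt ?normr_real ?real1 //; apply/negP => b1.
have hb : h.[b] = 0.
  rewrite ht horner_split_poly; apply/eqP; rewrite mulf_eq0; apply/orP; right.
  by rewrite prodf_seq_eq0; apply/hasP; exists b => //=; rewrite subrr.
have gb : g.[b] != 0.
  rewrite horner_split_poly !mulf_neq0 // prodf_seq_neq0.
  apply/allP => a /(allP all1) a1 /=; rewrite subr_eq0.
  by apply: contraTneq b1 => ->; rewrite -real_leNgt ?normr_real ?real1.
have := norm_split_poly_le_reflected c s (ltW b1); rewrite -/f -/g.
have -> : f.[b] = l * g.[b].
  by apply/eqP; rewrite -subr_eq0 -hornerZ -hornerN -hornerD -/h hb.
by rewrite normrM ger_pMl ?normr_gt0 // lt_geF.
Qed.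

(** Evaluate X^N - 1 = prod (X - w^i) at a / x and multiply by x^N. *)
Lemma norm_prod_unity_roots N w x a : N.-primitive_root w -> x != 0 ->
  \prod_(0 <= i < N) `|x * w ^+ i - a| = `|x ^+ N - a ^+ N|.
Proof.
move=> pw x0.
have prodY y : \prod_(0 <= i < N) `|w ^+ i - y| = `|y ^+ N - 1|.
  have := congr1 (fun p => `|p.[y]|) (factor_Xn_sub_1 pw).
  rewrite horner_prod !hornerE normr_prod => <-.
  by apply: eq_bigr => i _; rewrite !hornerE distrC.
transitivity (\prod_(0 <= i < N) (`|x| * `|w ^+ i - a / x|)).
  by apply: eq_bigr => i _; rewrite -normrM mulrBr mulrCA divff // mulr1.
rewrite big_split /= prodY prodr_const_nat subn0 -normrX -normrM mulrBr mulr1.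
by rewrite exprMn exprVn mulrCA divff ?mulr1 ?expf_neq0 // distrC.
Qed.

Lemma norm_split_poly_unity_roots N w x c s : N.-primitive_root w -> x != 0 ->
  \prod_(0 <= i < N) `|(split_poly c s).[x * w ^+ i]| =
    `|c| ^+ N * \prod_(a <- s) `|x ^+ N - a ^+ N|.
Proof.
move=> pw x0.
under eq_bigr do rewrite horner_split_poly normrM normr_prod.
rewrite big_split /= prodr_const_nat subn0 exchange_big /=; congr (_ * _).
by apply: eq_bigr => a _; rewrite norm_prod_unity_roots.
Qed.

(* On a circle of radius r > 1 the roots in the closed unit disk cannot make a factor of
   the product over the sampling points small, even if they lie on the unit circle. *)
Lemma root_mahler_sampling N w r c s d t : N.-primitive_root w ->
  1 < r -> 2 <= r ^+ N ->
  all (fun a => (`|a| <= 1) || (2 * r ^+ N <= `|a| ^+ N)) s ->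
  all (fun a => `|a| <= 1) t ->
  (forall z, 1 < `|z| -> `|(split_poly c s).[z]| <= `|(split_poly d t).[z]|) ->
  root_mahler c s ^+ N <= 2 ^+ size s * (r ^+ N + 1) ^+ size t * `|d| ^+ N.
Proof.
move=> pw r1 rN sP tP st; have r0 : 0 < r := lt_trans ltr01 r1.
have rNn : `|r ^+ N| = r ^+ N by rewrite ger0_norm ?exprn_ge0 ?ltW.
have wN i : `|w ^+ i| = 1.
  rewrite normrX; suff -> : `|w| = 1 by rewrite expr1n.
  apply/eqP; rewrite -(@eqrXn2 _ N) ?(prim_order_gt0 pw) //.
  by rewrite -normrX (prim_expr_order pw) normr1 expr1n.
have : \prod_(0 <= i < N) `|(split_poly c s).[r * w ^+ i]| <=
       \prod_(0 <= i < N) `|(split_poly d t).[r * w ^+ i]|.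
  apply: ler_prod => i _; rewrite normr_ge0 st //.
  by rewrite normrM wN mulr1 gtr0_norm.
rewrite !norm_split_poly_unity_roots ?gt_eqF // => le_st.
(* Each factor loses at most 2: a root in the disk gives |r^N - a^N| >= 2 - 1, and |a|^N >= 2 r^N
   gives |r^N - a^N| >= |a|^N / 2. *)
have lower : \prod_(a <- s) outer a ^+ N <= 2 ^+ size s * \prod_(a <- s) `|r ^+ N - a ^+ N|.
  elim: s sP {st le_st} => [|a s IHs] /=; first by rewrite !big_nil mulr1.
  case/andP=> aP /IHs {}IHs; rewrite !big_cons exprS mulrACA.
  apply: ler_pM => //; first by rewrite exprn_ge0 // (le_trans ler01) ?outer_ge1.
    by apply: prodr_ge0 => b _; rewrite exprn_ge0 // (le_trans ler01) ?outer_ge1.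
  rewrite /outer; case: ifPn aP => [a1 _|_ /= a1].
    rewrite expr1n -[leLHS]mulr1; apply: ler_pM; rewrite ?ler01 ?ler1n //.
    rewrite (le_trans _ (lerB_dist _ _)) // lerBrDr rNn.
    by rewrite (le_trans _ rN) // -[2]/(1 + 1) lerD2l normrX exprn_ile1.
  rewrite distrC -ler_pdivrMl ?ltr0n // (le_trans _ (lerB_dist _ _)) //.
  rewrite rNn normrX lerBrDr -lerBrDl.
  have -> : `|a| ^+ N - 2^-1 * `|a| ^+ N = `|a| ^+ N / 2 by field.
  by rewrite ler_pdivlMr ?ltr0n // mulrC.
have upper : \prod_(a <- t) `|r ^+ N - a ^+ N| <= (r ^+ N + 1) ^+ size t.
  elim: t tP {st le_st} => [|a t IHt] /=; first by rewrite big_nil.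
  case/andP=> a1 /IHt {}IHt; rewrite big_cons exprS; apply: ler_pM => //.
    exact: prodr_ge0.
  rewrite (le_trans (ler_normB _ _)) // rNn.
  by rewrite lerD2l normrX exprn_ile1.
rewrite exprMn -prodrXl (le_trans (ler_wpM2l _ lower)) ?exprn_ge0 //.
rewrite mulrCA -mulrA ler_wpM2l ?exprn_ge0 ?ler0n //.
by rewrite (le_trans le_st) // mulrC ler_wpM2r ?exprn_ge0.
Qed.

Lemma split_poly_cons c a s :
  split_poly c (a :: s) = split_poly c s * 'X - a *: split_poly c s.
Proof.
rewrite /split_poly big_cons mulrBl scalerBr -scalerAl (mulrC _ 'X); congr (_ - _).
by rewrite mul_polyC !scalerA mulrC.
Qed.

(** For nonzero roots this is X^n f(1/X), with n the degree of f = [split_poly c s]; its leading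
    coefficient is f(0). *)
Definition reversed_poly c s :=
  split_poly (c * \prod_(a <- s) - a) [seq a^-1 | a <- s].

(** Induction on the roots: a new root a multiplies f by X - a and its reversal by -a (X - 1/a) = 1
    - a X. *)
Lemma coef_reversed_poly c s i j : all (fun a => a != 0) s ->
  (i + j = size s)%N -> (reversed_poly c s)`_i = (split_poly c s)`_j.
Proof.
rewrite /reversed_poly; elim: s i j => [|a s IHs] i j /=.
  by rewrite big_nil mulr1; case: i j => [|i] [|j].
case/andP=> a0 /IHs {}IHs ij.
have big0 d t m : (size t < m)%N -> (split_poly d t : {poly K})`_m = 0.
  move=> tm; rewrite nth_default //.
  by rewrite (leq_trans (size_scale_leq _ _)) // size_prod_XsubC.
have scl d k t : split_poly (d * k) t = d *: split_poly k t :> {poly K}.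
  by rewrite /split_poly scalerA.
(* The coefficients just past the degree enter in the boundary cases i = 0 and j = 0. *)
have f0 := big0 c s (size s).+1 (leqnn _).
have g0 : (split_poly (c * \prod_(b <- s) - b) [seq b^-1 | b <- s])`_(size s).+1 = 0.
  by apply: big0; rewrite size_map.
rewrite split_poly_cons big_cons mulrCA scl split_poly_cons.
move: (split_poly c s) (split_poly _ _) IHs f0 g0 => f g IHs f0 g0.
rewrite scalerA mulrN mulVf // scaleN1r opprK -scalerAl.
rewrite !(coefD, coefN, coefZ, coefMX).
case: i j ij => [|i] [|j] //=; rewrite ?add0n ?addn0 ?addSn ?addnS => -[ij].
- rewrite mulr0 add0r (IHs 0%N j) ?add0n // ij f0.
  by rewrite mulr0 subr0.
- by rewrite (IHs i 0%N) ?addn0 // ij g0 addr0 add0r mulNr.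
- rewrite (IHs i j.+1) ?addnS // (IHs i.+1 j) ?addSn //.
  by rewrite mulNr addrC.
Qed.

(** Factor by factor, |a| max(1, 1/|a|) = max(1, |a|). *)
Lemma root_mahler_reversed c s : all (fun a => a != 0) s ->
  root_mahler (c * \prod_(a <- s) - a) [seq a^-1 | a <- s] = root_mahler c s.
Proof.
move=> s0; rewrite /root_mahler normrM -mulrA; congr (_ * _).
rewrite normr_prod big_map -big_split /= !big_seq.
apply: eq_bigr => a /(allP s0) a0; rewrite normrN /outer normfV.
have a_gt0 : 0 < `|a| by rewrite normr_gt0.
rewrite invf_le1 //; have [a1|a1] := real_leP (normr_real a) (real1 K); last first.
  by rewrite (ltW a1) mulr1.
have [a1'|_] := real_leP (real1 K) (normr_real a); last by rewrite divff ?gt_eqF.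
by rewrite mulr1; apply/eqP; rewrite eq_le a1 a1'.
Qed.

End RootSequences.

Local Open Scope classical_set_scope.
Local Open Scope ring_scope.
Local Open Scope complex_scope.

(** * Mahler measure of the derivative *)

Section Circle.
Variable R : realType.
Local Notation C := R[i].
Local Notation normc := (@Normc.normc R).

Lemma normc_ge0 (z : C) : 0 <= normc z.
Proof. by rewrite -lecR; exact: (normr_ge0 z). Qed.

Lemma unit_circleD (x y : R) :
  unit_circle (x + y) = unit_circle x * unit_circle y.
Proof.
rewrite /unit_circle mulrDr cosD sinD.
apply/eqP; rewrite eq_complex /=; apply/andP; split; apply/eqP => //.
by rewrite addrC.
Qed.

Lemma unit_circle0 : unit_circle (0 : R) = 1.
Proof. by rewrite /unit_circle mulr0 cos0 sin0. Qed.

Lemma unit_circleMn (x : R) n : unit_circle (n%:R * x) = unit_circle x ^+ n.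
Proof.
elim: n => [|n IHn]; first by rewrite mul0r unit_circle0.
by rewrite exprS -IHn -unit_circleD mulrSr mulrDl mul1r addrC.
Qed.

Lemma norm_unit_circle (x : R) : `|unit_circle x| = 1.
Proof. by rewrite normc_def /= cos2Dsin2 sqrtr1. Qed.

Lemma unit_circle_neq0 (x : R) : unit_circle x != 0.
Proof. by rewrite -normr_gt0 norm_unit_circle. Qed.

Lemma unit_circle1 : unit_circle (1 : R) = 1.
Proof. by rewrite /unit_circle mulr1 mulr_natl cos2pi sin2pi. Qed.

Lemma unit_circle_neq1 (x : R) : 0 < x < 1 -> unit_circle x != 1.
Proof.
move=> /andP[x0 x1]; apply/eqP => /(congr1 (@complex.Re R)) /=.
rewrite -mulrA mulr_natl cos_mulr2n cos2sin2 => H.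
have : 0 < sin (pi * x) by apply: sin_gt0_pi; rewrite mulr_gt0 ?pi_gt0 //= gtr_pMr ?pi_gt0.
move=> /(mulr_gt0 (ltr0Sn R 1)); nra.
Qed.

Lemma unit_circle_prim_root n : (0 < n)%N ->
  n.-primitive_root (unit_circle (n%:R^-1 : R)).
Proof.
move=> n0; rewrite /primitive_root_of_unity n0; apply/forallP => -[i /= ilt].
rewrite unity_rootE -unit_circleMn; apply/eqP.
have n0' : 0 < n%:R :> R by rewrite ltr0n.
have [->|neq] := eqVneq i.+1 n.
  by rewrite divff ?(gt_eqF n0') // unit_circle1 eqxx.
apply/negbTE/unit_circle_neq1; rewrite divr_gt0 ?ltr0n //=.
by rewrite ltr_pdivrMr // mul1r ltr_nat ltn_neqAle neq.
Qed.

(** A constant independent of N disappears under N-th roots: if y < x, then D (y / x)^N tends to 0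
    and cannot stay above 1. *)
Lemma le_of_exprn_le (x y D : R) : 0 <= x -> 0 <= y ->
  (\forall N \near \oo, x ^+ N <= D * y ^+ N) -> x <= y.
Proof.
move=> x0 y0 H; rewrite leNgt; apply/negP => yx.
have xp : 0 < x by exact: le_lt_trans yx.
have yx1 : `|y / x| < 1.
  by rewrite ger0_norm ?divr_ge0 // ltr_pdivrMr // mul1r.
have /cvgrPdist_lt/(_ 1 ltr01) := cvg_geometric D yx1.
move=> H'.
near \oo => N.
have h1 : x ^+ N <= D * y ^+ N by near: N.
have : `|0 - geometric D (y / x) N| < 1 by near: N.
rewrite sub0r normrN /geometric /= => h2.
have := le_lt_trans (ler_norm _) h2.
rewrite expr_div_n mulrA ltr_pdivrMr ?exprn_gt0 // mul1r.
by rewrite ltNge h1.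
Unshelve. all: by end_near.
Qed.

(** This supplies, with D = 2 e, the dichotomy on the roots in [root_mahler_sampling]: finitely many
    |a| > 1 have powers growing geometrically. *)
Lemma near_outside_circle (D : R) (s : seq C) : \forall N \near \oo,
  all (fun a => (`|a| <= 1) || (D%:C <= `|a| ^+ N)) s.
Proof.
elim: s => [|a s IHs]; first by near=> N.
have Ha : \forall N \near \oo, (`|a| <= 1) || (D%:C <= `|a| ^+ N).
  have [a1|] := boolP (`|a| <= 1); first by near=> N.
  rewrite -real_ltNge ?normr_real ?real1 // => a1 /=.
  have a1' : 1 < normc a by rewrite -ltcR.
  have ai : `|(normc a)^-1| < 1.
    by rewrite ger0_norm ?invr_ge0 ?invf_lt1 // ?(ltW (lt_trans ltr01 a1')) // (lt_trans ltr01 a1').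
  have /cvgrPdist_lt/(_ 1 ltr01) H := cvg_geometric D ai.
  near=> N.
  have : `|0 - geometric D (normc a)^-1 N| < 1 by near: N.
  rewrite sub0r normrN /geometric /= => h2.
  have := le_lt_trans (ler_norm _) h2.
  rewrite exprVn ltr_pdivrMr ?exprn_gt0 ?(lt_trans ltr01 a1') // mul1r => /ltW.
  by rewrite -lecR rmorphXn.
near=> N => /=; apply/andP; split; near: N; [exact: Ha | exact: IHs].
Unshelve. all: by end_near.
Qed.

(** Sampling at radius r = exp(1/N) keeps r^N = e, so the loss in [root_mahler_sampling] does not
    depend on N and [le_of_exprn_le] removes it. *)
Lemma root_mahler_le (c d : C) (s t : seq C) :
  all (fun a => `|a| <= 1) t ->
  (forall z, 1 < `|z| -> `|(split_poly c s).[z]| <= `|(split_poly d t).[z]|) ->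
  root_mahler c s <= `|d|.
Proof.
move=> t1 st.
have mE : (complex.Re (root_mahler c s))%:C = root_mahler c s.
  by rewrite RRe_real // ger0_real ?root_mahler_ge0.
have m0 : 0 <= complex.Re (root_mahler c s) by rewrite -lecR mE root_mahler_ge0.
rewrite -mE lecR.
apply: (@le_of_exprn_le _ _ (2 ^+ size s * (expR 1 + 1) ^+ size t)) => //.
  exact: normc_ge0.
near=> N.
have N0 : (0 < N)%N by near: N; exact: nbhs_infty_gt.
have rN : (expR (N%:R^-1) : R) ^+ N = expR 1.
  by rewrite -expRM_natl divff // pnatr_eq0 -lt0n.
have := @root_mahler_sampling _ N _ (expR N%:R^-1)%:C c s d t (unit_circle_prim_root N0).
have rNC : (expR (N%:R^-1) : R)%:C ^+ N = (expR 1)%:C by rewrite -rmorphXn /= rN.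
rewrite rNC => H.
rewrite -lecR rmorphM /= rmorphXn /= mE.
rewrite [leRHS](_ : _ = 2 ^+ size s * ((expR 1)%:C + 1) ^+ size t * `|d| ^+ N).
  apply: H => //.
  - by have := expR_gt1 (N%:R^-1 : R); rewrite invr_gt0 ltr0n N0 -ltcR.
  - by have := expR_ge1Dx (1 : R); rewrite -lecR rmorphD.
  - have -> : 2 * (expR 1)%:C = (2 * expR 1)%:C :> C by rewrite rmorphM rmorph_nat.
    near: N; exact: near_outside_circle.
by rewrite !rmorphM !rmorphXn !rmorphD.
Unshelve. all: by end_near.
Qed.

(** Let g be the reflected polynomial. By Gauss-Lucas g' has its roots in the disk, and its leading
    coefficient has modulus n [root_mahler c s], n the degree; by [bernstein] it dominates f'
    outside the disk. *)
Lemma root_mahler_deriv (c d : C) (s t : seq C) : c != 0 -> (0 < size s)%N ->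
  (split_poly c s)^`() = split_poly d t ->
  root_mahler d t <= (size s)%:R * root_mahler c s.
Proof.
move=> c0 s0 E.
set o := \prod_(a <- s) outer a.
have o0 : o != 0 by rewrite gt_eqF // (lt_le_trans ltr01) ?prod_outer_ge1.
have [u gE] := split_polyP (reflected c s)^`().
have sg : size (reflected c s) = (size s).+1.
  by rewrite size_split_poly ?mulf_neq0 // size_map.
have gn : (reflected c s)^`()`_(size s).-1 = (size s)%:R * (c * o).
  rewrite coef_deriv prednK // -[LHS]mulr_natl; congr (_ * _).
  rewrite -[RHS](lead_coef_split_poly _ (map (@inward _) s)) lead_coefE.
  by rewrite -/(reflected c s) sg.
have sg' : size (reflected c s)^`() = size s.
  apply/eqP; rewrite eqn_leq; apply/andP; split.
    by rewrite -ltnS -sg lt_size_deriv // -size_poly_gt0 sg.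
  rewrite leqNgt; apply/negP => lt.
  move: gn; rewrite nth_default; last by rewrite -ltnS prednK.
  move/esym/eqP; rewrite !mulf_eq0 (negbTE c0) (negbTE o0) pnatr_eq0.
  by rewrite eqn0Ngt s0.
have ld : lead_coef (reflected c s)^`() = (size s)%:R * (c * o).
  by rewrite lead_coefE sg' gn.
rewrite ld in gE.
have -> : (size s)%:R * root_mahler c s = `|(size s)%:R * (c * o)|.
  by rewrite !normrM normr_nat (ger0_norm (le_trans ler01 (prod_outer_ge1 s))).
apply: (@root_mahler_le _ _ _ u); last first.
  by move=> z z1; rewrite -E -gE; exact: bernstein.
apply/allP => a au; rewrite real_leNgt ?normr_real ?real1 //; apply/negP => a1.
have := @gauss_lucas _ (c * o) (map (@inward _) s) a.
rewrite mulf_neq0 // size_map s0 a1 all_map.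
rewrite -/(reflected c s) gE => /(_ isT isT) H.
have : all (fun b => `|inward b| <= 1) s by apply/allP => b _; exact: inward_le1.
move=> /H /(_ isT).
by rewrite horner_split_poly (big_rem a au) /= subrr mul0r mulr0 eqxx.
Qed.

End Circle.

(** * Coefficients of sparse polynomials *)

Section Sparse.
Variable R : realType.
Local Notation C := R[i].
Implicit Types (c d : C) (s t : seq C) (E : seq nat).

(** The case 2e >= n of the induction, stated with its induction hypothesis so that it serves both f
    and its reversal. The derivative loses the exponent 0, hence e |f_e| <= 2^(k-3) n M'(f), and n
    <= 2e. *)
Lemma norm_coef_deriv_step c s E e : c != 0 ->
  (forall d t E', d != 0 -> (size t < size s)%N ->
    (forall i, (split_poly d t)`_i != 0 -> i \in E') ->
    forall e', `|(split_poly d t)`_e'| <= 2 ^+ (size E' - 2) * root_mahler d t) ->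
  (forall i, (split_poly c s)`_i != 0 -> i \in E) ->
  (split_poly c s)`_0 != 0 -> (0 < e)%N -> (size s <= e.*2)%N -> (2 < size E)%N ->
  `|(split_poly c s)`_e| <= 2 ^+ (size E - 2) * root_mahler c s.
Proof.
move=> c0 IH sE f0 e0 se E3.
have [->|fe] := eqVneq (split_poly c s)`_e 0.
  by rewrite normr0 mulr_ge0 ?exprn_ge0 ?ler0n ?root_mahler_ge0.
have [t ft] := split_polyP (split_poly c s)^`().
move: ft; set d := lead_coef _ => ft.
have f'e : (split_poly d t)`_e.-1 = (split_poly c s)`_e *+ e.
  by rewrite -ft coef_deriv prednK.
have f'e0 : (split_poly d t)`_e.-1 != 0 by rewrite f'e mulrn_eq0 negb_or -lt0n e0.
have d0 : d != 0.
  by apply: contraNneq f'e0 => d0; rewrite /split_poly d0 scale0r coef0.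
have ts : (size t < size s)%N.
  rewrite -ltnS -(size_split_poly t d0) -(size_split_poly s c0) -ft.
  by rewrite lt_size_deriv // -size_poly_gt0 size_split_poly.
pose E' := [seq i.-1 | i <- E & i != 0%N].
have tE' i : (split_poly d t)`_i != 0 -> i \in E'.
  rewrite -ft coef_deriv mulrn_eq0 negb_or => /andP[_ /sE iE].
  by apply/mapP; exists i.+1 => //; rewrite mem_filter.
have sE' : (size E' <= (size E).-1)%N.
  rewrite size_map size_filter -ltnS prednK; last by case: (E) E3.
  rewrite -(count_predC (fun i => i != 0%N) E) -addn1 leq_add2l.
  by rewrite -has_count; apply/hasP; exists 0%N => //; apply: sE.
have := IH d t E' d0 ts tE' e.-1; rewrite f'e normrMn.
move=> /le_trans H; have {H} := H _ (ler_wpM2l _ (root_mahler_deriv c0 (leq_trans _ ts) ft)).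
rewrite exprn_ge0 // => /(_ isT isT) H.
rewrite -(ler_pMn2r e0) (le_trans H) //.
rewrite mulrA -mulrnAl ler_wpM2r ?root_mahler_ge0 //.
have -> : (size E - 2 = (size E - 3).+1)%N by lia.
rewrite exprSr -mulrnAr -[2 *+ e]mulr_natr -natrM mul2n.
apply: ler_pM; rewrite ?exprn_ge0 ?ler0n ?ler_nat //.
by rewrite -!natrX ler_nat leq_pexp2l //; lia.
Qed.

Lemma norm_coef_le_root_mahler c s E e : c != 0 ->
  (forall i, (split_poly c s)`_i != 0 -> i \in E) ->
  `|(split_poly c s)`_e| <= 2 ^+ (size E - 2) * root_mahler c s.
Proof.
have [n] := ubnP (size s); elim: n c s E e => // n IHn c s E e.
rewrite ltnS => sn c0 sE.
have IH d t E' : d != 0 -> (size t < size s)%N ->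
    (forall i, (split_poly d t)`_i != 0 -> i \in E') ->
    forall e', `|(split_poly d t)`_e'| <= 2 ^+ (size E' - 2) * root_mahler d t.
  by move=> d0 ts tE e'; apply: IHn => //; apply: leq_trans sn.
(* Truncated subtraction keeps the power of 2 at least 1 even for short E. *)
have easy : `|(split_poly c s)`_e| <= root_mahler c s ->
    `|(split_poly c s)`_e| <= 2 ^+ (size E - 2) * root_mahler c s.
  move=> /le_trans; apply; rewrite ler_peMl ?root_mahler_ge0 //.
  by rewrite exprn_ege1 // ler1n.
have [fe|fe] := eqVneq (split_poly c s)`_e 0.
  by apply: easy; rewrite fe normr0 root_mahler_ge0.
(* If f(0) = 0, divide by X: the root 0 contributes the factor 1 to [root_mahler], and shifting E
   keeps its length. *)
have [f0|f0] := eqVneq (split_poly c s)`_0 0.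
  have s0 : 0 \in s.
    move: f0; rewrite -horner_coef0 horner_split_poly => /eqP.
    rewrite mulf_eq0 (negbTE c0) /= prodf_seq_eq0 => /hasP[a sa] /=.
    by rewrite sub0r oppr_eq0 => /eqP <-.
  have fX : split_poly c s = split_poly c (rem 0 s) * 'X.
    rewrite /split_poly (perm_big _ (perm_to_rem s0)) big_cons subr0.
    by rewrite -scalerAl mulrC.
  have mX : root_mahler c s = root_mahler c (rem 0 s).
    rewrite /root_mahler (perm_big _ (perm_to_rem s0)) big_cons.
    have -> : outer 0 = 1 :> C by rewrite /outer normr0 ler01.
    by rewrite /= mul1r.
  case: e fe {easy} => [|e] fe; first by rewrite f0 eqxx in fe.
  rewrite mX fX coefMX /= (le_trans (IH c (rem 0 s) [seq i.-1 | i <- E] _ _ _ e)) //.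
  - by rewrite size_rem //; case: (s) s0.
  - move=> i fi; apply/mapP; exists i.+1 => //; apply: sE.
    by rewrite fX coefMX.
  - by rewrite size_map.
have [e0|e0] := posnP e.
  by apply: easy; rewrite e0 norm_coef0_le_root_mahler.
have lead : (split_poly c s)`_(size s) = c.
  by rewrite -[RHS](lead_coef_split_poly c s) lead_coefE size_split_poly.
have [en|en] := eqVneq e (size s).
  by apply: easy; rewrite en lead norm_le_root_mahler.
have es : (e < size s)%N.
  rewrite ltn_neqAle en -ltnS -(size_split_poly s c0) ltnNge.
  by apply: contra fe => /leq_sizeP ->.
(* The distinct exponents 0, e and n all occur, so [size E - 2] is positive and one factor 2 can be
   spent. *)
have E3 : (2 < size E)%N.
  apply: (@uniq_leq_size _ [:: 0%N; e; size s]) => /=.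
    by rewrite !inE andbT !negb_or en; lia.
  by move=> i; rewrite !inE => /or3P[] /eqP ->; apply: sE; rewrite // lead.
have [se|se] := leqP (size s) e.*2; first exact: norm_coef_deriv_step.
have snz : all (fun a => a != 0) s.
  apply/allP => a sa; apply: contraNneq f0 => a0.
  rewrite -horner_coef0 horner_split_poly (big_rem a sa) /= a0 subrr mul0r.
  by rewrite mulr0.
(* For 2e < n pass to the reversal, where the coefficient sits at n - e and 2 (n - e) >= n. *)
set c' := c * \prod_(a <- s) - a; set s' := [seq a^-1 | a <- s].
have c'0 : c' != 0.
  rewrite mulf_neq0 // prodf_seq_neq0; apply/allP => a /(allP snz).
  by rewrite oppr_eq0.
rewrite -(@coef_reversed_poly _ c s (size s - e) e) ?subnK ?(ltnW es) //.
rewrite -(root_mahler_reversed c snz) -(size_map (fun i => size s - i)%N E).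
apply: norm_coef_deriv_step; rewrite ?size_map //.
- move=> i fi; have si : (i <= size s)%N.
    rewrite -ltnS -[size s](size_map (@GRing.inv C)) -(size_split_poly s' c'0).
    by rewrite ltnNge; apply: contra fi => /leq_sizeP ->.
  apply/mapP; exists (size s - i)%N; last by rewrite subKn.
  by apply: sE; rewrite -(@coef_reversed_poly _ c s i) // subnKC.
- by rewrite (@coef_reversed_poly _ c s 0 (size s)) // lead.
- by rewrite subn_gt0.
- by move: (size s) se => m; lia.
Qed.

End Sparse.

(** * Lower bound for the integral *)

Section Integration.
Variable R : realType.
Local Notation C := R[i].
Local Notation normc := (@Normc.normc R).
Local Notation mu := (@lebesgue_measure R).

(* No measurability is needed: the integral of a nonnegative function is a supremum over
   the simple functions below it, and [leeB] holds for all extended reals. *)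
Lemma le_integral_pointwise d (T : measurableType d) (m : {measure set T -> \bar R})
    (D : set T) (f g : T -> \bar R) :
  (forall x, D x -> (f x <= g x)%E) ->
  (\int[m]_(x in D) f x <= \int[m]_(x in D) g x)%E.
Proof.
move=> fg; have fgD x : ((f \_ D) x <= (g \_ D) x)%E.
  by rewrite /patch; case: ifPn => // /[!inE]; exact: fg.
rewrite /integral; apply: leeB; apply: le_ereal_sup => _ [h /= hf <-]; exists h => //= x.
  apply: le_trans (hf x) _; rewrite !funeposE.
  by rewrite ge_max !le_max fgD lexx orbT.
apply: le_trans (hf x) _; rewrite !funenegE.
by rewrite ge_max !le_max leeN2 fgD lexx orbT.
Qed.

(** Its integral is a Riemann sum, which brings averages over sampling points within reach of
    Fatou's lemma. The half-open cells partition [0, 1) and omit 1. *)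
Definition step_fun (n : nat) (v : nat -> R) (x : R) : R :=
  \sum_(k < n) v k * \1_(`[k%:R / n%:R, k.+1%:R / n%:R[) x.

Lemma step_funE n v x : (0 < n)%N -> 0 <= x < 1 ->
  step_fun n v x = v (Num.truncn (n%:R * x)).
Proof.
move=> n0 /andP[x0 x1]; have n0' : 0 < n%:R :> R by rewrite ltr0n.
have nx0 : 0 <= n%:R * x by rewrite mulr_ge0.
have /andP[t1 t2] := truncn_itv nx0.
have tn : (Num.truncn (n%:R * x) < n)%N.
  by rewrite -(ltr_nat R) (le_lt_trans t1) // gtr_pMr.
rewrite /step_fun (bigD1 (Ordinal tn)) //= big1 ?addr0 => [|k kt].
  rewrite indicE mem_set ?mulr1 //= in_itv /=.
  by rewrite ler_pdivrMr // ltr_pdivlMr // (mulrC x) t1 t2.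
rewrite indicE memNset ?mulr0 //= in_itv /= ler_pdivrMr // ltr_pdivlMr //.
rewrite (mulrC x) => /truncn_def ke; move/eqP: kt; apply.
by apply/val_inj; rewrite /= ke.
Qed.

Lemma measurable_step_fun (D : set R) n v : measurable_fun D (step_fun n v).
Proof.
by apply: measurable_sum => k; exact: measurable_funM.
Qed.

Lemma integral_step_fun n v : (0 < n)%N -> (forall k, 0 <= v k) ->
  (\int[mu]_(x in `[0%R, 1%R[) (step_fun n v x)%:E =
   ((\sum_(k < n) v k) / n%:R)%:E)%E.
Proof.
move=> n0 v0; have n0' : 0 < n%:R :> R by rewrite ltr0n.
under eq_integral do rewrite /step_fun -sumEFin.
rewrite ge0_integral_sum //=; last 2 first.
- by move=> k; apply/measurable_EFinP; exact: measurable_funM.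
- by move=> k x _; rewrite lee_fin mulr_ge0.
rewrite mulr_suml -sumEFin; apply: eq_bigr => k _.
transitivity ((v k)%:E *
    \int[mu]_(x in `[0%R, 1%R[) (\1_(`[k%:R / n%:R, k.+1%:R / n%:R[) x)%:E)%E.
  have -> := @integralZl_indic _ _ _ mu `[0%R, 1%R[%classic (measurable_itv _)
    (fun=> `[k%:R / n%:R, k.+1%:R / n%:R[%classic) (v k) => //.
  by rewrite ltNge v0.
rewrite integral_indic //= setIidl; last first.
  move=> x /=; rewrite !in_itv /= => /andP[x1 x2]; apply/andP; split.
    by rewrite (le_trans _ x1) // divr_ge0.
  by rewrite (lt_le_trans x2) // ler_pdivrMr // mul1r ler_nat.
rewrite lebesgue_measure_itv /= lte_fin ltr_pM2r ?invr_gt0 // ltr_nat ltnSn.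
by rewrite -EFinD -mulrBl -natrB // subSnn mul1r -EFinM.
Qed.

Lemma cvg_truncn (x : R) : 0 <= x ->
  (Num.truncn (n.+1%:R * x))%:R / n.+1%:R @[n --> \oo] --> x.
Proof.
move=> x0.
apply/cvgrPdist_le => e e0.
have /cvgrPdist_le/(_ e e0) H := @cvg_harmonic R.
near=> n.
have Hn : n.+1%:R^-1 <= e.
  have : `|0 - harmonic n| <= e by near: n.
  by rewrite /harmonic sub0r normrN ger0_norm ?invr_ge0.
have n0 : 0 < n.+1%:R :> R by [].
have /truncn_itv/andP[t1 t2] : 0 <= n.+1%:R * x by rewrite mulr_ge0.
have le : (Num.truncn (n.+1%:R * x))%:R / n.+1%:R <= x.
  by rewrite ler_pdivrMr // (mulrC x).
rewrite ger0_norm ?subr_ge0 //.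
apply: le_trans Hn.
rewrite lerBlDr -[X in X + _]mul1r -mulrDl ler_pdivlMr // mulrC addrC.
by rewrite natr1 ltW.
Unshelve. all: by end_near.
Qed.

Lemma cvg_normc (u : nat -> C) (z : C) :
  complex.Re (u n) @[n --> \oo] --> complex.Re z ->
  complex.Im (u n) @[n --> \oo] --> complex.Im z ->
  normc (u n) @[n --> \oo] --> normc z.
Proof.
move=> ure uim.
have E w : normc w = Num.sqrt (complex.Re w ^+ 2 + complex.Im w ^+ 2) by case: w.
under eq_fun do rewrite E; rewrite E.
apply: continuous_cvg; first exact: sqrt_continuous.
by apply: cvgD; rewrite expr2; under eq_fun do rewrite expr2; exact: cvgM.
Qed.

Lemma normc_split_poly (c : C) (s : seq C) z :
  normc (split_poly c s).[z] = normc c * \prod_(a <- s) normc (z - a).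
Proof.
rewrite horner_split_poly Normc.normcM; congr (_ * _).
elim: s => [|a s IHs]; first by rewrite !big_nil Normc.normc1.
by rewrite !big_cons Normc.normcM IHs.
Qed.

Lemma cvg_normc_split_poly (c : C) (s : seq C) (u : nat -> C) (z : C) :
  complex.Re (u n) @[n --> \oo] --> complex.Re z ->
  complex.Im (u n) @[n --> \oo] --> complex.Im z ->
  normc (split_poly c s).[u n] @[n --> \oo] --> normc (split_poly c s).[z].
Proof.
move=> ure uim; under eq_fun do rewrite normc_split_poly; rewrite normc_split_poly.
apply: cvgM; first exact: cvg_cst.
elim: s => [|a s IHs].
  by rewrite big_nil; under eq_fun do rewrite big_nil; exact: cvg_cst.
rewrite big_cons; under eq_fun do rewrite big_cons.
apply: cvgM => //; apply: cvg_normc.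
  rewrite raddfB /=; under eq_fun do rewrite raddfB /=.
  by apply: cvgB => //; exact: cvg_cst.
rewrite raddfB /=; under eq_fun do rewrite raddfB /=.
by apply: cvgB => //; exact: cvg_cst.
Qed.

(** The radius exceeds 1, so that no root in the closed disk is met; it tends to 1, and its (n+1)-th
    power is e. *)
Definition sample (n : nat) (k : nat) : C :=
  (expR (n.+1%:R^-1))%:C * unit_circle (k%:R / n.+1%:R).

Lemma cvg_sample (c : C) (s : seq C) (x : R) : 0 <= x ->
  normc (split_poly c s).[sample n (Num.truncn (n.+1%:R * x))] @[n --> \oo] -->
  normc (split_poly c s).[unit_circle x].
Proof.
move=> x0; have xn := cvg_truncn x0.
have rn : expR (n.+1%:R^-1) @[n --> \oo] --> (1 : R).
  rewrite -[X in _ --> X]expR0; apply: continuous_cvg; first exact: continuous_expR.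
  exact: cvg_harmonic.
have tn : 2 * pi * ((Num.truncn (n.+1%:R * x))%:R / n.+1%:R) @[n --> \oo] --> 2 * pi * x.
  by apply: cvgM => //; exact: cvg_cst.
apply: cvg_normc_split_poly; rewrite /sample /unit_circle /=.
  rewrite -[X in _ --> X]mul1r; under eq_fun do rewrite mul0r subr0.
  by apply: cvgM => //; apply: continuous_cvg => //; exact: continuous_cos.
rewrite -[X in _ --> X]mul1r; under eq_fun do rewrite mul0r addr0.
by apply: cvgM => //; apply: continuous_cvg => //; exact: continuous_sin.
Qed.

(** The case y = 0, with limit -oo, occurs at roots on the unit circle. *)
Lemma cvg_lne (u : nat -> R) (y : R) : (forall n, 0 < u n) -> 0 <= y ->
  u n @[n --> \oo] --> y ->
  (ln (u n))%:E @[n --> \oo] --> lne y%:E.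
Proof.
move=> u0 y0 uy; have [y1|y1] := ltP 0 y.
  rewrite lne_EFin //; apply: cvg_EFin; first by near=> n.
  apply: continuous_cvg => //; exact: continuous_ln.
rewrite le0_lneNy ?lee_fin //.
apply/cvgeNyPle => A; near=> n.
rewrite lee_fin -[A]expRK ler_ln ?posrE ?expR_gt0 //.
near: n.
move: uy => /cvgrPdist_le/(_ (expR A) (expR_gt0 A)); apply: filterS => n.
have -> : y = 0 by apply/eqP; rewrite eq_le y0 y1.
by rewrite sub0r normrN ger0_norm // ltW.
Unshelve. all: by end_near.
Qed.

Lemma normc_split_poly_le (c : C) (s : seq C) (z : C) (r : R) :
  all (fun a => `|a| <= 1) s -> normc z <= r ->
  normc (split_poly c s).[z] <= normc c * (r + 1) ^+ size s.
Proof.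
move=> s1 zr; rewrite -lecR rmorphM rmorphXn rmorphD /=.
rewrite -[leLHS]/(`|(split_poly c s).[z]|) horner_split_poly normrM.
rewrite ler_wpM2l // normr_prod; elim: s s1 => [|a s IHs] /=; first by rewrite big_nil.
case/andP=> a1 /IHs {}IHs; rewrite big_cons exprS ler_pM ?prodr_ge0 //.
by rewrite (le_trans (ler_normB _ _)) // lerD // -[leLHS]/((normc z)%:C) lecR.
Qed.

Lemma ln_prod (n : nat) (u : nat -> R) : (forall k, 0 < u k) ->
  \sum_(0 <= k < n) ln (u k) = ln (\prod_(0 <= k < n) u k).
Proof.
move=> u0; elim: n => [|n IHn]; first by rewrite !big_geq ?ln1.
by rewrite !big_nat_recr //= IHn lnM ?posrE ?prodr_gt0.
Qed.

(** With N = n + 1 the product over the sampling points is |c|^N prod |e - a^N|, and each |e - a^N|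
    >= e - 1 >= 1. *)
Lemma sum_ln_sample (c : C) (s : seq C) (n : nat) : c != 0 ->
  all (fun a => `|a| <= 1) s ->
  (forall k, 0 < normc (split_poly c s).[sample n k]) ->
  n.+1%:R * ln (normc c) <=
    \sum_(0 <= k < n.+1) ln (normc (split_poly c s).[sample n k]).
Proof.
move=> c0 s1 p0; rewrite ln_prod // mulr_natl.
have nc0 : 0 < normc c by rewrite -ltcR; rewrite -normr_gt0 in c0.
rewrite -lnXn // ler_ln ?posrE ?exprn_gt0 ?prodr_gt0 //.
rewrite -lecR rmorphXn rmorph_prod /=.
have pw := unit_circle_prim_root R (ltn0Sn n).
have rn : (expR (n.+1%:R^-1) : R)%:C ^+ n.+1 = (expR 1)%:C.
  by rewrite -rmorphXn /= -expRM_natl divff // pnatr_eq0.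
have r0 : (expR (n.+1%:R^-1) : R)%:C != 0.
  by rewrite gt_eqF // -[0]/(0%:C) ltcR expR_gt0.
have := norm_split_poly_unity_roots c s pw r0; rewrite rn.
under eq_bigr => k _ do rewrite -unit_circleMn.
rewrite -[X in X = _ -> _]/(\prod_(0 <= k < n.+1) (normc (split_poly c s).[sample n k])%:C).
move=> ->; rewrite -[leLHS]mulr1 ler_wpM2l ?exprn_ge0 ?lecR ?normc_ge0 //.
elim: s s1 {p0} => [|a s IHs] /=; first by rewrite big_nil.
case/andP=> a1 /IHs {}IHs; rewrite big_cons -[leLHS]mulr1 ler_pM //.
rewrite (le_trans _ (lerB_dist _ _)) // lerBrDr.
rewrite (@le_trans _ _ (1 + 1)) // ?lerD2l ?normrX ?exprn_ile1 //.
rewrite ger0_norm; last by rewrite -[0]/(0%:C) lecR ltW ?expR_gt0.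
by have := expR_ge1Dx (1 : R); rewrite -lecR rmorphD.
Qed.

(** Fatou's lemma is applied to the nonnegative functions B - log |g| at the sampling points, whose
    integrals are at most B - log |c|. *)
Lemma ln_le_integral_split_poly (c : C) (s : seq C) : c != 0 ->
  all (fun a => `|a| <= 1) s ->
  ((ln (normc c))%:E <=
   \int[mu]_(x in `[0%R, 1%R]) lne (normc (split_poly c s).[unit_circle x])%:E)%E.
Proof.
move=> c0 s1.
set phi := fun x : R => lne (normc (split_poly c s).[unit_circle x])%:E.
have nc0 : 0 < normc c by rewrite -ltcR; rewrite -normr_gt0 in c0.
have u0 n k : 0 < normc (split_poly c s).[sample n k].
  rewrite -ltcR -[ltRHS]/(`|(split_poly c s).[sample n k]|) normr_gt0.
  rewrite horner_split_poly mulf_neq0 // prodf_seq_neq0.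
  apply/allP => a /(allP s1) a1 /=; rewrite subr_eq0; apply: contraTneq a1 => <-.
  rewrite /sample normrM norm_unit_circle mulr1 -real_ltNge ?real1 ?normr_real //.
  rewrite ger0_norm ?ltW //; last by rewrite -[0]/(0%:C) ltcR expR_gt0.
  by have := expR_gt1 (n.+1%:R^-1 : R); rewrite invr_gt0 ltr0n -ltcR.
(* A bound uniform in n: the sampling radius is at most e and the roots have modulus at most 1. *)
pose B := ln (normc c * (expR 1 + 1) ^+ size s).
have uB n k : ln (normc (split_poly c s).[sample n k]) <= B.
  rewrite ler_ln ?posrE ?u0 //; last first.
    by rewrite mulr_gt0 // exprn_gt0 // addr_gt0 // expR_gt0.
  apply: normc_split_poly_le => //.
  rewrite /sample Normc.normcM -lecR.
  have -> : normc (unit_circle (k%:R / n.+1%:R)) = 1.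
    exact/(@complexI R)/norm_unit_circle.
  rewrite mulr1 lecR /= expr0n addr0 sqrtr_sqr ger0_norm ?expR_ge0 //.
  by rewrite ler_expR invf_le1 // ler1n.
pose v n k := B - ln (normc (split_poly c s).[sample n k]).
pose f n x := (step_fun n.+1 (v n) x)%:E.
pose D := `[0%R, 1%R[%classic : set R.
have v0 n k : 0 <= v n k by rewrite subr_ge0.
have mf n : measurable_fun D (f n).
  by apply/measurable_EFinP; exact: measurable_step_fun.
have fcvg x : D x -> f n x @[n --> \oo] --> (B%:E - phi x)%E.
  rewrite /D /= in_itv /= => /andP[x0 x1].
  rewrite (_ : (fun n => f n x) = fun n =>
    (B%:E - (ln (normc (split_poly c s).[sample n (Num.truncn (n.+1%:R * x))]))%:E)%E); last first.
    by apply/funext => n; rewrite /f step_funE ?x0 // -EFinB.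
  apply: cvgeB; [|exact: cvg_cst|].
    by rewrite fin_num_adde_defr.
  by apply: cvg_lne => //; [exact: normc_ge0|exact: cvg_sample].
(* Measurability of [phi] itself comes from this pointwise limit of step functions. *)
have mpsi : measurable_fun D (fun x => (B%:E - phi x)%E).
  exact: emeasurable_fun_cvg mf fcvg.
have psi0 x : D x -> (0 <= B%:E - phi x)%E.
  move=> Dx; have fx := fcvg x Dx; rewrite -(cvg_lim _ fx) //.
  apply: lime_ge; first by apply/cvg_ex; eexists; exact: fx.
  near=> n; rewrite lee_fin sumr_ge0 // => k _.
  by rewrite mulr_ge0.
have fint n : (\int[mu]_(x in D) f n x <= (B - ln (normc c))%:E)%E.
  rewrite integral_step_fun // lee_fin ler_pdivrMr // -(big_mkord xpredT (v n)).
  rewrite sumrB /= sumr_const_nat subn0 mulrBl -[B *+ _]mulr_natr.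
  by rewrite lerD2l lerN2 mulrC sum_ln_sample.
have psiint : (\int[mu]_(x in D) (B%:E - phi x) <= (B - ln (normc c))%:E)%E.
  have := fatou mu (measurable_itv _ : measurable D) mf.
  have f0 n x : D x -> (0 <= f n x)%E.
    by move=> _; rewrite lee_fin sumr_ge0 // => k _; rewrite mulr_ge0.
  move=> /(_ f0).
  have -> : (\int[mu]_(x in D) limn_einf (f^~ x) = \int[mu]_(x in D) (B%:E - phi x))%E.
    by apply: eq_integral => x /[!inE] /fcvg/cvg_limn_einf_sup[].
  move=> /le_trans; apply; rewrite limn_einf_lim; apply: lime_le; first exact: is_cvg_einfs.
  near=> n; apply: le_trans (fint n).
  by apply: ereal_inf_lbound; exists n => /=.
have intD (r : \bar R) : (\int[mu]_(x in D) (cst r) x = r)%E.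
  rewrite integral_cst; last exact: measurable_itv.
  rewrite -[RHS]mule1; congr (_ * _)%E.
  by rewrite /= lebesgue_measure_itv /= lte_fin ltr01 oppr0 adde0.
have iB : mu.-integrable D (fun=> B%:E).
  apply/integrableP; split; first exact: measurable_cst.
  by rewrite (intD (`|B%:E|)%E) /= ltry.
have ipsi : mu.-integrable D (fun x => (B%:E - phi x)%E).
  apply/integrableP; split => //.
  have -> : (\int[mu]_(x in D) `|B%:E - phi x| = \int[mu]_(x in D) (B%:E - phi x))%E.
    by apply: eq_integral => x /[!inE] /psi0; exact: gee0_abs.
  exact: le_lt_trans psiint (ltry _).
(* This also holds where [phi x] is -oo; integrability of [B - phi] then lets the integral be
   split. *)
have phiE x : (phi x = B%:E - (B%:E - phi x))%E.
  by case: (phi x) => [r| |] //=; rewrite -!EFinB; congr EFin; lra.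
rewrite -integral_itv_bndo_bndc; last first.
  rewrite (_ : (fun x => _) = (fun x => (B%:E - (B%:E - phi x))%E)).
    by apply: emeasurable_funB => //; exact: measurable_cst.
  by apply/funext => x; exact: phiE.
have -> : (\int[mu]_(x in D) phi x = \int[mu]_(x in D) (B%:E - (B%:E - phi x)))%E.
  by apply: eq_integral => x _; exact: phiE.
have -> : (\int[mu]_(x in D) (B%:E - (B%:E - phi x)) = B%:E - \int[mu]_(x in D) (B%:E - phi x))%E.
  have := integralB _ iB ipsi; rewrite (intD B%:E); apply; exact: measurable_itv.
apply: le_trans (leeB (lexx _) psiint).
by rewrite -EFinB lee_fin; lra.
Unshelve. all: by end_near.
Qed.

End Integration.

(** * Laurent polynomials in several variables *)

Section Laurent.
Variable R : realType.
Local Notation C := R[i].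
Local Notation normc := (@Normc.normc R).
Local Notation mu := (@lebesgue_measure R).

Lemma lne_EFin_le (x y : R) : x <= y -> (lne x%:E <= lne y%:E)%E.
Proof.
move=> xy; have [x0|x0] := leP x 0; first by rewrite le0_lneNy ?lee_fin ?leNye.
have y0 := lt_le_trans x0 xy.
by rewrite !lne_EFin // lee_fin ler_ln ?posrE.
Qed.

(** A power of z, of modulus 1 on the circle, turns the sum into a polynomial p. Reflecting the
    roots of p keeps the integrand, and the new leading coefficient has modulus [root_mahler d s],
    which bounds the coefficients. *)
Lemma lne_coef_le_integral (N : seq int) (a : int -> C) (n : int) :
  uniq N -> n \in N ->
  (lne (normc (a n) / 2 ^+ (size N - 2))%:E <=
   \int[mu]_(x in `[0%R, 1%R])
     lne (normc (\sum_(k <- N) a k * unit_circle x ^ k))%:E)%E.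
Proof.
move=> uN nN.
have [an0|an0] := eqVneq (a n) 0.
  by rewrite an0 Normc.normc0 mul0r le0_lneNy ?leNye.
(* Large enough that k + m >= 0 for every exponent k in [N]. *)
pose m := (\sum_(k <- N) absz k)%N.
pose e (k : int) := absz (k + m%:Z).
have eE k : k \in N -> (e k)%:Z = k + m%:Z.
  move=> kN; rewrite gez0_abs // -lerBlDr sub0r -[X in _ <= X]opprK lerN2.
  have : (absz k <= m)%N by rewrite /m (big_rem k kN) /= leq_addr.
  by lia.
pose p := \sum_(k <- N) a k *: 'X^(e k) : {poly C}.
have pn : p`_(e n) = a n.
  rewrite /p coef_sum (bigD1_seq n) //= coefZ coefXn eqxx mulr1 big_seq_cond.
  rewrite big1 ?addr0 // => k /andP[kN kn].
  rewrite coefZ coefXn; case: eqP => [ee|]; last by rewrite mulr0.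
  by move: kn; rewrite -(inj_eq (addIr m%:Z)) -!eE // ee eqxx.
have pE i : p`_i != 0 -> i \in map e N.
  apply: contraR => iN; rewrite /p coef_sum big_seq big1 // => k kN.
  rewrite coefZ coefXn; case: eqP => [ie|]; last by rewrite mulr0.
  by case/negP: iN; rewrite ie map_f.
have p_circle (x : R) : normc p.[unit_circle x] =
    normc (\sum_(k <- N) a k * unit_circle x ^ k).
  have -> : p.[unit_circle x] =
      (\sum_(k <- N) a k * unit_circle x ^ k) * unit_circle x ^ m%:Z.
    rewrite /p horner_sum mulr_suml; apply: eq_big_seq => k kN.
    rewrite hornerZ hornerXn -mulrA -expfzDr ?unit_circle_neq0 // -eE //.
  rewrite Normc.normcM [X in _ * X](_ : _ = 1) ?mulr1 //.
  apply: (@complexI R); rewrite -[LHS]/(`|unit_circle x ^ m%:Z|).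
  by rewrite -exprnP normrX norm_unit_circle expr1n.
have [s ps] := split_polyP p.
set d := lead_coef p in ps.
have d0 : d != 0.
  by rewrite lead_coef_eq0; apply: contraNneq an0 => p0; rewrite -pn p0 coef0.
set d' := d * \prod_(b <- s) outer b.
have d'0 : d' != 0.
  by rewrite mulf_neq0 // gt_eqF // (lt_le_trans ltr01) ?prod_outer_ge1.
have dm : `|d'| = root_mahler d s.
  by rewrite normrM (ger0_norm (le_trans ler01 (prod_outer_ge1 s))).
have disk : all (fun b => `|b| <= 1) (map (@inward _) s).
  by rewrite all_map; apply/allP => b _; exact: inward_le1.
have := ln_le_integral_split_poly d'0 disk.
have -> : (\int[mu]_(x in `[0%R, 1%R])
    lne (normc (split_poly d' (map (@inward _) s)).[unit_circle x])%:E =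
  \int[mu]_(x in `[0%R, 1%R])
    lne (normc (\sum_(k <- N) a k * unit_circle x ^ k))%:E)%E.
  apply: eq_integral => x _; rewrite -p_circle; congr (lne (_%:E)).
  apply: (@complexI R); rewrite ps.
  exact: (norm_reflected d s (norm_unit_circle x)).
apply: le_trans.
have nd' : 0 < normc d' by rewrite -ltcR; rewrite -normr_gt0 in d'0.
rewrite -(lne_EFin nd'); apply: lne_EFin_le.
rewrite ler_pdivrMr ?exprn_gt0 // mulrC -lecR rmorphM rmorphXn /=.
rewrite -[X in _ <= _ * X]/(`|d'|) dm -[leLHS]/(`|a n|) -pn ps.
rewrite rmorph_nat -(size_map e N); apply: norm_coef_le_root_mahler => // i.
by rewrite -ps; exact: pE.
Qed.

Lemma le_cube_integral l (f g : l.-tuple R -> \bar R) :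
  (forall t, (f t <= g t)%E) -> (cube_integral f <= cube_integral g)%E.
Proof.
elim: l f g => [|l IHl] f g fg /=; first exact: fg.
by apply: IHl => t; apply: le_integral_pointwise => x _; exact: fg.
Qed.

(** The exponents form a list apart from the coefficients, so that the induction can split them by
    first entry and rescale [c]. *)
Definition laurent_sum l (J : seq (l.-tuple int)) (c : l.-tuple int -> C)
    (t : l.-tuple R) : C :=
  \sum_(j <- J) c j * \prod_(i < l) unit_circle (tnth t i) ^ tnth j i.

Lemma laurent_sum_cons l (J : seq (l.+1.-tuple int)) (c : l.+1.-tuple int -> C)
    (x : R) (t : l.-tuple R) :
  laurent_sum J c [tuple of x :: t] =
  \sum_(n <- undup [seq thead j | j <- J])
    (\sum_(j <- J | thead j == n)
       c j * \prod_(i < l) unit_circle (tnth t i) ^ tnth (behead_tuple j) i) *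
    unit_circle x ^ n.
Proof.
under eq_bigr do rewrite mulr_suml.
rewrite (exchange_big_dep xpredT) //=; apply: eq_big_seq => j jJ.
rewrite -big_filter (_ : [seq _ <- _ | _] = [:: thead j]); last first.
  under eq_filter do rewrite eq_sym.
  by rewrite filter_pred1_uniq ?undup_uniq // mem_undup map_f.
rewrite big_seq1 big_ord_recl !tnth0 -mulrA; congr (_ * _); rewrite mulrC.
congr (_ * _); apply: eq_bigr => i _.
rewrite tnthS tnth_behead; congr (_ ^ tnth j _).
by apply/val_inj; rewrite /= inordK // ltnS ltn_ord.
Qed.

Lemma lne_coef_le_cube_integral l (J : seq (l.-tuple int))
    (c : l.-tuple int -> C) (j : l.-tuple int) :
  uniq J -> j \in J ->
  (lne (normc (c j) / 2 ^+ (size J - 2))%:E <=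
   cube_integral (fun t => lne (normc (laurent_sum J c t))%:E))%E.
Proof.
elim: l J c j => [|l IHl] J c j uJ jJ.
  (* There is only one 0-tuple, and the truncated exponent 1 - 2 is 0. *)
  have J1 : J = [:: j].
    case: J uJ jJ => [|i [|k J]] //=; first by rewrite inE => _ /eqP ->.
    by rewrite !inE (tuple0 i) (tuple0 k).
  rewrite /= /laurent_sum J1 big_seq1 big_ord0 mulr1 /=.
  by rewrite expr0 divr1.
pose N := undup [seq thead i | i <- J].
pose bh (i : l.+1.-tuple int) : l.-tuple int := behead_tuple i.
pose J0 := [seq bh i | i <- J & thead i == thead j].
pose q : R := 2 ^+ (size N - 2).
have q0 : 0 < q by rewrite exprn_gt0.
(* The loss q of the one-variable bound is put into the coefficients, so that the induction
   hypothesis speaks of a_n / q. *)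
pose c0 (i : l.-tuple int) := c [tuple of thead j :: i] / q%:C.
have consK (i : l.+1.-tuple int) : [tuple of thead i :: bh i] = i.
  by apply/val_inj; rewrite [in RHS](tuple_eta i).
have uJ0 : uniq J0.
  rewrite map_inj_in_uniq ?filter_uniq // => i k.
  rewrite !mem_filter => /andP[/eqP ij _] /andP[/eqP kj _] ik.
  by rewrite -(consK i) -(consK k) ij kj ik.
have jJ0 : bh j \in J0.
  by apply/mapP; exists j => //; rewrite mem_filter eqxx.
(* Every first exponent other than that of j takes at least one monomial outside [J0]. As both sizes
   are positive, the truncated exponents of 2 add up to at most [size J - 2]. *)
have sizes : (size N + size J0 <= (size J).+1)%N.
  have sub : {subset N <= thead j :: [seq thead i | i <- J & thead i != thead j]}.
    move=> n; rewrite mem_undup inE => /mapP[i iJ ->].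
    have [//|ij] := eqVneq (thead i) (thead j); apply/mapP; exists i => //.
    by rewrite mem_filter ij.
  have := uniq_leq_size (undup_uniq _) sub; rewrite /= size_map size_filter.
  rewrite /J0 size_map size_filter -(count_predC (fun i => thead i == thead j) J).
  by rewrite -/N addnC -addnS leq_add2l.
have sN : (0 < size N)%N.
  have : thead j \in N by rewrite mem_undup map_f.
  by case: (N).
have sJ0 : (0 < size J0)%N by case: (J0) jJ0.
have := IHl J0 c0 (bh j) uJ0 jJ0; rewrite /c0 consK => IH.
apply: (@le_trans _ _ (lne (normc (c j / q%:C) / 2 ^+ (size J0 - 2))%:E)).
  apply: lne_EFin_le; rewrite Normc.normcM Normc.normcV.
  have -> : normc q%:C = q by rewrite /= expr0n addr0 sqrtr_sqr gtr0_norm.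
  rewrite -mulrA ler_wpM2l ?normc_ge0 // -invfM -exprD lef_pV2 ?posrE ?exprn_gt0 //.
  by rewrite -!natrX ler_nat leq_pexp2l //; lia.
apply: (le_trans IH); apply: le_cube_integral => t.
pose a n := \sum_(i <- J | thead i == n)
   c i * \prod_(k < l) unit_circle (tnth t k) ^ tnth (bh i) k.
have -> : laurent_sum J0 c0 t = a (thead j) / q%:C.
  rewrite /laurent_sum big_map big_filter mulr_suml; apply: eq_bigr => i /eqP ij.
  by rewrite /c0 -ij consK mulrAC.
rewrite Normc.normcM Normc.normcV.
have -> : normc q%:C = q by rewrite /= expr0n addr0 sqrtr_sqr gtr0_norm.
have := @lne_coef_le_integral N a (thead j) (undup_uniq _).
rewrite mem_undup map_f // => /(_ isT) /le_trans; apply.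
apply: le_integral_pointwise => x _.
by rewrite laurent_sum_cons.
Qed.

End Laurent.

Theorem corollary2 (R : realType) (k l : nat) (F : laurent R l)
    (hk : (2 <= k)%N) (hl : (1 <= l)%N)
    (hF0 : F <> [fsfun]%fset) (hF : sum_of_monomials k F) :
  ((height F / 2 ^+ (k - 2))%:E <= mahler_measure F)%E.
Proof.
have sF : (size (finsupp F) <= k)%N.
  have [J [c [<- ->]]] := hF; apply: fsubset_leq_card.
  apply/fsubsetP => j; rewrite mem_finsupp fsfunE.
  by case: ifP => //; rewrite eqxx.
have q0 : 0 < 2 ^+ (k - 2) :> R by rewrite exprn_gt0.
suff coef_le j : j \in finsupp F ->
    ((Normc.normc (F j) / 2 ^+ (k - 2))%:E <= mahler_measure F)%E.
  (* The maximum starts from 0, so the bound is checked for 0 and for each coefficient. *)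
  rewrite /height big_seq.
  apply: (big_ind (fun x : R => (x / 2 ^+ (k - 2))%:E <= mahler_measure F)%E).
  - by rewrite mul0r expeR_ge0.
  - by move=> x y hx hy; rewrite /Num.max; case: ifP.
  - exact: coef_le.
(* Some of the k coefficients may vanish; the support gives the stronger bound. *)
move=> jF; apply: (@le_trans _ _ (Normc.normc (F j) / 2 ^+ (size (finsupp F) - 2))%:E).
  rewrite lee_fin ler_wpM2l ?normc_ge0 // lef_pV2 ?posrE ?exprn_gt0 //.
  by rewrite -!natrX ler_nat leq_pexp2l //; lia.
set y := (_ / _); have y0 : 0 <= y by rewrite divr_ge0 ?normc_ge0 // exprn_ge0.
have /eqP <- : expeR (lne y%:E) == y%:E by rewrite lneK_eq lee_fin.
rewrite lee_expeR; apply: le_trans (lne_coef_le_cube_integral F (fset_uniq _) jF) _.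
apply: le_cube_integral => t.
rewrite /laurent_sum /laurent_eval.
by under [in X in (_ <= X)%E]eq_bigr do under eq_bigr do rewrite tnth_map.
Qed.
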